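(* There exist even contact $4$-manifolds $(M,\mathcal{E})$ that contain an infinite family of Legendrian $2$-tori which are pairwise non-isotopic as Legendrian tori, but such that all members of the family are smoothly isotopic to one another in $M$.
   Context: Everything is smooth; all manifolds and all geometric structures on them are assumed to be oriented and cooriented. An even contact structure on a $4$-manifold $M$ is a rank-$3$ distribution $\mathcal{E}\subset TM$ that is locally the kernel of a $1$-form $\alpha$ with $\alpha\wedge d\alpha$ nowhere vanishing. The pair $(M,\mathcal{E})$ is called an even contact $4$-manifold. An embedded $2$-torus $L$ in $(M,\mathcal{E})$ is called Legendrian if it is everywhere tangent to $\mathcal{E}$, i.e. $TL\subset\mathcal{E}$. Two Legendrian tori are isotopic (as Legendrian tori) if there is a smooth homotopy between them through embedded Legendrian tori. They are smoothly isotopic if there is a smooth homotopy between them through smooth embeddings $T^2\to M$. *)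

(* Defs.v *)
From HB Require Import structures.
From mathcomp Require Import all_boot all_order all_algebra.
From mathcomp Require Import boolp classical_sets functions reals topology.
From mathcomp Require Import normedtype derive.

Set Implicit Arguments.
Unset Strict Implicit.
Unset Printing Implicit Defensive.

Import Order.TTheory GRing.Theory Num.Theory.
Import numFieldNormedType.Exports.
Local Open Scope classical_set_scope.
Local Open Scope ring_scope.

(* Meaningful for D open; V and W are meant to be finite dimensional, so that
   "df is C^k" amounts to "x |-> df(x) v is C^k for every v". *)
Fixpoint Ck_on (R : realType) (V W : normedModType R) (k : nat) (D : set V)
    (f : V -> W) : Prop :=
  if k is k'.+1 then
    (forall x, D x -> differentiable f x) /\
    (forall v, Ck_on k' D (fun x => 'D_v f x))
  else forall x, D x -> {for x, continuous f}.

Definition smooth_on (R : realType) (V W : normedModType R) (D : set V)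
    (f : V -> W) : Prop := forall k, Ck_on k D f.

(* A topological chart; cinv is junk outside the image of cdom. *)
Record chart (R : realType) (n : nat) (T : topologicalType) := Chart {
  cdom : set T;
  cmap : T -> 'rV[R]_n;
  cinv : 'rV[R]_n -> T;
  cdom_open : open cdom;
  cimg_open : open (cmap @` cdom);
  cmapK : {in cdom, cancel cmap cinv};
  cmap_continuous : {within cdom, continuous cmap};
  cinv_continuous : {within cmap @` cdom, continuous cinv} }.

(* Smooth oriented n-manifolds without boundary. The atlas is the family of the
   charts [chart_at p], one around each point p, which costs no generality: the
   oriented smooth structure is the one this atlas generates. The charts being
   labelled by points, the tangent space T_pM is 'rV[R]_n, a tangent vector at p
   being given by its components in the chart [chart_at p]. *)
Record oriented_manifold (R : realType) (n : nat) := OrientedManifold {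
  carrier :> topologicalType;
  man_hausdorff : hausdorff_space carrier;
  man_second_countable : @second_countable carrier;
  chart_at : carrier -> chart R n carrier;
  mem_chart_at : forall p, cdom (chart_at p) p;
  transition_smooth : forall p q,
    smooth_on (cmap (chart_at p) @` (cdom (chart_at p) `&` cdom (chart_at q)))
              (cmap (chart_at q) \o cinv (chart_at p));
  transition_oriented : forall p q x,
    (cmap (chart_at p) @` (cdom (chart_at p) `&` cdom (chart_at q))) x ->
    0 < \det (jacobian (cmap (chart_at q) \o cinv (chart_at p)) x) }.

Section Manifold.
Variables (R : realType) (n : nat) (M : oriented_manifold R n).

Definition smooth_map (V : normedModType R) (f : V -> M) : Prop :=
  continuous f /\
  forall q : M, smooth_on (f @^-1` cdom (chart_at q)) (cmap (chart_at q) \o f).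

(* Matrix of the differential T_sR^m -> T_(f s)M, acting on row vectors. *)
Definition tangent_mx (m : nat) (f : 'rV[R]_m -> M) (s : 'rV[R]_m) :
    'M[R]_(m, n) :=
  jacobian (cmap (chart_at (f s)) \o f) s.

(* A covector at p is a column w, sending v in T_pM to the scalar v *m w. *)
Definition one_form := M -> 'cV[R]_n.

Definition pairing (w : 'cV[R]_n) (v : 'rV[R]_n) : R := (v *m w) 0 0.

(* Components of a in the chart [chart_at q], at the point of coordinates x:
   a at the corresponding point r of M is expressed in [chart_at r], so it is
   pulled back along the change of charts. *)
Definition in_chart (a : one_form) (q : M) (x : 'rV[R]_n) : 'cV[R]_n :=
  let r := cinv (chart_at q) x in
  jacobian (cmap (chart_at r) \o cinv (chart_at q)) x *m a r.

Definition smooth_form_on (U : set M) (a : one_form) : Prop :=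
  forall q : M,
    smooth_on (cmap (chart_at q) @` (cdom (chart_at q) `&` U)) (in_chart a q).

(* (da)_p(v, w) = v(a(w)) - w(a(v)), the constant extensions of v and w in the
   chart [chart_at p] having zero Lie bracket. *)
Definition ext_deriv (a : one_form) (p : M) (v w : 'rV[R]_n) : R :=
  let x := cmap (chart_at p) p in
  'D_v (fun y => pairing (in_chart a p y) w) x -
  'D_w (fun y => pairing (in_chart a p y) v) x.

Definition wedge_da (a : one_form) (p : M) (u v w : 'rV[R]_n) : R :=
  pairing (a p) u * ext_deriv a p v w +
  pairing (a p) v * ext_deriv a p w u +
  pairing (a p) w * ext_deriv a p u v.

End Manifold.

(* Cooriented even contact structures. [ec_pos p] is the positive side of the
   hyperplane [ec_dist p]; requiring the local forms to be positive on it says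
   that the coorientation is continuous. The orientation of the distribution is
   the one determined by those of M and of the normal direction. Smoothness of
   the distribution follows from being locally the kernel of a smooth form. *)
Record even_contact (R : realType) (M : oriented_manifold R 4) :=
  EvenContact {
  ec_dist : M -> {vspace 'rV[R]_4};
  ec_pos : M -> set 'rV[R]_4;
  ec_rank : forall p, \dim (ec_dist p) = 3%N;
  ec_local : forall p : M, exists (U : set M) (a : one_form M),
    [/\ open U, U p, smooth_form_on U a &
      forall q, U q ->
        [/\ forall v, v \in ec_dist q <-> pairing (a q) v = 0,
            forall v, ec_pos q v <-> 0 < pairing (a q) v &
            exists u v w, wedge_da a q u v w != 0]] }.

Section Tori.
Variables (R : realType) (M : oriented_manifold R 4).

(* Maps from T^2 = R^2/Z^2 to M are Z^2-periodic maps from R^2 to M; the second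
   clause says that f is well defined and injective on R^2/Z^2, the third one
   that it is an immersion. As T^2 is compact and M Hausdorff, this makes f a
   smooth embedding. *)
Definition embedded_torus (f : 'rV[R]_2 -> M) : Prop :=
  [/\ smooth_map f,
      forall s t, f s = f t <->
        exists k : 'rV[int]_2, s - t = map_mx (fun z : int => z%:~R) k &
      forall s, \rank (tangent_mx f s) = 2%N].

Definition legendrian_torus (E : even_contact M) (f : 'rV[R]_2 -> M) : Prop :=
  embedded_torus f /\
  forall (s v : 'rV[R]_2), v *m tangent_mx f s \in ec_dist E (f s).

(* The embeddings f and g parametrize the same oriented submanifold of M. *)
Definition same_oriented_torus (f g : 'rV[R]_2 -> M) : Prop :=
  range f = range g /\
  forall s t, f s = g t ->
    exists2 A : 'M[R]_2, 0 < \det A & tangent_mx f s = A *m tangent_mx g t.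

(* Isotopy of the oriented submanifolds parametrized by f and g, rather than of
   their parametrizations. The homotopy has time interval R instead of `[0, 1],
   which is harmless: a smooth homotopy over `[0, 1] can be reparametrized by a
   smooth map R -> `[0, 1] sending 0 to 0 and 1 to 1. *)
Definition isotopic_through (P : ('rV[R]_2 -> M) -> Prop)
    (f g : 'rV[R]_2 -> M) : Prop :=
  exists F : R * 'rV[R]_2 -> M,
    [/\ smooth_map F,
        forall t : R, 0 <= t <= 1 -> P (fun s => F (t, s)),
        same_oriented_torus (fun s => F (0, s)) f &
        same_oriented_torus (fun s => F (1, s)) g].

Definition smoothly_isotopic := isotopic_through embedded_torus.

Definition legendrian_isotopic (E : even_contact M) :=
  isotopic_through (legendrian_torus E).

End Tori.

(* Main.v *)
Require Import Defs.
From HB Require Import structures.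
From mathcomp Require Import all_boot all_order all_algebra.
From mathcomp Require Import boolp classical_sets functions reals topology.
From mathcomp Require Import normedtype derive.
From mathcomp Require Import cardinality landau trigo.
From mathcomp Require Import ring lra.

(* On T^2 x R^2 with coordinates (x, theta, y, z), the form
   dz - y dx - f(z) dtheta is even contact, and the tori y = 0, z = z_k with
   f(z_k) = 0 are Legendrian; moving z shows that they are smoothly isotopic.
   They are Legendrian rigid: on a Legendrian torus C^1-close to one of them,
   dx and dtheta are independent and dz = y dx + f(z) dtheta, so y = 0 and
   f(z) = 0 where z is extremal; if the zeros of f are isolated, z is constant,
   then y = 0, and the torus is the original one. By connectedness of the
   interval, a Legendrian isotopy starting at one of the tori stays there.
   To have a manifold with a single chart, we use the product of two punctured
   planes in R^4, x and theta being the polar angles, y = u - 1 and z = w for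
   the squared radii u and w, and f(w) = w sin(w); the form is multiplied by
   u. *)

Set Implicit Arguments.
Unset Strict Implicit.
Unset Printing Implicit Defensive.

Import Order.TTheory GRing.Theory Num.Theory.
Import numFieldNormedType.Exports.
Local Open Scope classical_set_scope.
Local Open Scope ring_scope.

Local Notation k0 := (ord0 : 'I_4).
Local Notation k1 := (lift ord0 ord0 : 'I_4).
Local Notation k2 := (lift ord0 (lift ord0 ord0) : 'I_4).
Local Notation k3 := (lift ord0 (lift ord0 (lift ord0 ord0)) : 'I_4).
Local Notation j0 := (ord0 : 'I_2).
Local Notation j1 := (lift ord0 ord0 : 'I_2).
Local Notation e0 := (delta_mx ord0 j0).
Local Notation e1 := (delta_mx ord0 j1).

(** * Stability of C^k maps under the usual operations *)

Section Smoothness.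
Variables (R : realType) (V : normedModType R).

(** The first-order expansion of [f] at [x] is also one of [g], and uniqueness of the differential
    identifies the two. *)
Lemma near_eq_differentiable (W : normedModType R) (f g : V -> W) (x : V) :
  {near x, f =1 g} -> differentiable f x -> differentiable g x.
Proof.
move=> fg /diff_locallyP[cdf dfx].
have dg : g \o shift x = cst (g x) + 'd f x +o_ 0 id.
  apply/eqaddoP => e e0; move/eqaddoP : dfx => /(_ e e0) dfx.
  have fg0 : \forall h \near 0, f (h + x) = g (h + x).
    suff sx : (fun h => h + x) @ (0 : V) --> x by exact: (sx _ fg).
    rewrite -[X in _ --> X]add0r.
    by apply: cvgD; [exact: cvg_id|exact: cvg_cst].
  near=> h; rewrite (_ : (_ - _) h = (f \o shift x - (cst (f x) + 'd f x)) h).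
    by near: h.
  rewrite /= !fctE/= (nbhs_singleton fg).
  by congr (_ - _); apply/esym; near: h.
have dgE := diff_unique cdf dg.
by apply/diff_locallyP; rewrite dgE.
Unshelve. all: by end_near. Qed.

(** As [D] is open, agreement on [D] is agreement near each of its points, which passes to
    derivatives. Formulas such as the Leibniz rule hold only on [D], and this lemma is what lets the
    inductions below use them. *)
Lemma Ck_on_eq (W : normedModType R) k (D : set V) (f g : V -> W) :
  open D -> (forall x, D x -> f x = g x) -> Ck_on k D f -> Ck_on k D g.
Proof.
elim: k f g => [|k IH] f g oD fg.
  move=> cf x Dx; apply: (@cvg_trans _ (f @ x)).
    by apply: near_eq_cvg; near=> y; apply: fg; near: y; exact: open_nbhs_nbhs.
  by rewrite -fg//; exact: cf.
have nfg x : D x -> \forall y \near x, f y = g y.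
  by move=> Dx; near=> y; apply: fg; near: y; exact: open_nbhs_nbhs.
move=> [df Df]; split => [x Dx|v].
  exact: near_eq_differentiable (nfg _ Dx) (df _ Dx).
apply: (IH _ _ oD _ (Df v)) => x Dx.
exact: near_eq_derive (nfg _ Dx).
Unshelve. all: by end_near. Qed.

Lemma Ck_on_le (W : normedModType R) k (D : set V) (f : V -> W) :
  Ck_on k.+1 D f -> Ck_on k D f.
Proof.
elim: k f => [|k IH] f [df Df].
  by move=> x Dx; apply: differentiable_continuous; exact: df.
by split => // v; exact: IH.
Qed.

Lemma Ck_on_cst (W : normedModType R) k (D : set V) (c : W) :
  Ck_on k D (fun=> c).
Proof.
elim: k c => [|k IH] c; first by move=> x _; exact: cvg_cst.
split => [x _|v]; first exact: differentiable_cst.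
have -> : (fun x : V => 'D_v (fun=> c) x) = fun=> 0.
  by apply/funext => x; exact: derive_cst.
exact: IH.
Qed.

Lemma Ck_on_linear (W : normedModType R) k (D : set V) (f : V -> W) :
  linear f -> continuous f -> Ck_on k D f.
Proof.
move=> lf cf.
pose g : {linear V -> W} := HB.pack f (GRing.isLinear.Build _ _ _ _ _ lf).
have df x : differentiable f x by exact: (@linear_differentiable _ _ _ g).
case: k => [|k]; first by move=> x _; exact: cf.
split => [x _|v]; first exact: df.
have -> : (fun x => 'D_v f x) = fun=> f v; last exact: Ck_on_cst.
apply/funext => x; rewrite (deriveE _ (df x)).
by have : 'd f x = f :> (V -> W) by [exact: (@diff_lin _ _ _ g x)]; move=> ->.
Qed.

Lemma Ck_onD (W : normedModType R) k (D : set V) (f g : V -> W) :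
  open D -> Ck_on k D f -> Ck_on k D g -> Ck_on k D (fun x => f x + g x).
Proof.
move=> oD; elim: k f g => [|k IH] f g.
  by move=> cf cg x Dx; apply: cvgD; [exact: cf|exact: cg].
move=> [df Df] [dg Dg]; split => [x Dx|v].
  by apply: differentiableD; [exact: df|exact: dg].
apply: (Ck_on_eq oD _ (IH _ _ (Df v) (Dg v))) => x Dx.
by rewrite deriveD//; apply: diff_derivable; [exact: df|exact: dg].
Qed.

Lemma Ck_onM k (D : set V) (f g : V -> R) :
  open D -> Ck_on k D f -> Ck_on k D g -> Ck_on k D (fun x => f x * g x).
Proof.
move=> oD; elim: k f g => [|k IH] f g.
  by move=> cf cg x Dx; apply: cvgM; [exact: cf|exact: cg].
move=> Cf Cg; have [[df Df] [dg Dg]] := (Cf, Cg); split => [x Dx|v].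
  by apply: differentiableM; [exact: df|exact: dg].
apply: (Ck_on_eq oD _ (Ck_onD oD (IH _ _ (Ck_on_le Cf) (Dg v))
  (IH _ _ (Ck_on_le Cg) (Df v)))) => x Dx.
by rewrite deriveM//; apply: diff_derivable; [exact: df|exact: dg].
Qed.

Lemma differentiable_sin (x : R) : differentiable (@sin R) x.
Proof. exact/derivable1_diffP/derivable_sin. Qed.

Lemma differentiable_cos (x : R) : differentiable (@cos R) x.
Proof. exact/derivable1_diffP/derivable_cos. Qed.

Lemma derive_comp_real (g : R -> R) (f : V -> R) (x v : V) :
  differentiable f x -> differentiable g (f x) ->
  'D_v (fun y => g (f y)) x = 'D_1 g (f x) * 'D_v f x.
Proof.
move=> df dg; have dgf := differentiable_comp df dg.
rewrite (deriveE v df) (deriveE v dgf) (diff_comp df dg) /= (diff1E dg).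
by rewrite derive1E -[_ *: _]/(_ * _) mulrC.
Qed.

Lemma derive_sin_comp (f : V -> R) (x v : V) : differentiable f x ->
  'D_v (fun y => sin (f y)) x = cos (f x) * 'D_v f x.
Proof.
move=> df; rewrite (derive_comp_real _ df (differentiable_sin _)).
by rewrite derive_val.
Qed.

Lemma derive_cos_comp (f : V -> R) (x v : V) : differentiable f x ->
  'D_v (fun y => cos (f y)) x = - sin (f x) * 'D_v f x.
Proof.
move=> df; rewrite (derive_comp_real _ df (differentiable_cos _)).
by rewrite derive_val.
Qed.

(** Sine and cosine go together in the induction, since the derivative of each involves the
    other. *)
Lemma Ck_on_sincos k (D : set V) (f : V -> R) : open D -> Ck_on k D f ->
  Ck_on k D (fun x => sin (f x)) /\ Ck_on k D (fun x => cos (f x)).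
Proof.
move=> oD; elim: k f => [|k IH] f.
  move=> cf; split => x Dx.
    exact: (continuous_comp (cf _ Dx) (@continuous_sin _ _)).
  exact: (continuous_comp (cf _ Dx) (@continuous_cos _ _)).
move=> Cf; have [df Df] := Cf; have [Cs Cc] := IH _ (Ck_on_le Cf).
split; split => [x Dx|v].
- by apply: differentiable_comp; [exact: df|exact: differentiable_sin].
- apply: (Ck_on_eq oD _ (Ck_onM oD Cc (Df v))) => x Dx.
  by rewrite derive_sin_comp//; exact: df.
- by apply: differentiable_comp; [exact: df|exact: differentiable_cos].
- have Cm : Ck_on k D (fun=> -1 : R) by exact: Ck_on_cst.
  apply: (Ck_on_eq oD _ (Ck_onM oD (Ck_onM oD Cm Cs) (Df v))) => x Dx.
  by rewrite derive_cos_comp ?mulN1r//; exact: df.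
Qed.

Lemma differentiable_mx m n (f : V -> 'M[R]_(m, n)) x :
  (forall i j, differentiable (fun y => f y i j) x) -> differentiable f x.
Proof.
move=> df; rewrite (_ : f =
    \sum_i \sum_j (fun y => f y i j *: (delta_mx i j : 'M[R]_(m, n)))).
  by do 2 apply: differentiable_sum => ?; exact: differentiableZl.
apply/funext => y; rewrite {1}[f y]matrix_sum_delta fct_sumE.
by apply: eq_bigr => i _; rewrite fct_sumE.
Qed.

Lemma Ck_on_mx k (D : set V) m n (f : V -> 'M[R]_(m, n)) : open D ->
  (forall i j, Ck_on k D (fun x => f x i j)) -> Ck_on k D f.
Proof.
move=> oD; elim: k f => [|k IH] f Cf.
  move=> x Dx; apply/cvg_mx_entourageP => A eA.
  apply: filter_forall => i; apply: filter_forall => j.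
  rewrite !near_simpl; near=> y; apply/mem_set; near: y.
  by move: A eA; apply/cvg_app_entourageP; exact: Cf.
have df x : D x -> differentiable f x.
  by move=> Dx; apply: differentiable_mx => i j; exact: (Cf i j).1.
split=> [|v]; first exact: df.
apply: IH => i j.
apply: (Ck_on_eq oD _ ((Cf i j).2 v)) => x Dx.
by rewrite derive_mx ?mxE//; apply: diff_derivable; exact: df.
Unshelve. all: by end_near. Qed.

Lemma derive_coord m n (f : V -> 'M[R]_(m, n)) x v i j :
  differentiable f x -> ('D_v f x) i j = 'D_v (fun y => f y i j) x.
Proof.
by move=> df; rewrite derive_mx ?mxE//; exact: diff_derivable.
Qed.

End Smoothness.

(** * Open subsets of R^n as oriented manifolds with a single chart *)

Section OpenSubmanifold.
Variables (R : realType) (n : nat) (U : set 'rV[R]_n) (oU : open U) (pt : U).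

Let oinc : U -> 'rV[R]_n := \val.
(** The inverse of the inclusion is made total by sending the complement of [U] to [pt]. *)
Let oret (x : 'rV[R]_n) : U := insubd pt x.

Lemma image_val_setT : oinc @` setT = U.
Proof.
apply/seteqP; split => [_ [x _ <-]|x Ux]; first exact: set_valP.
by exists (SigSub (mem_set Ux)).
Qed.

Lemma oretK x : U x -> oinc (oret x) = x.
Proof. by move=> Ux; apply: insubdK; exact: mem_set. Qed.

Lemma continuous_val : continuous oinc.
Proof. exact: initial_continuous. Qed.

Lemma open_subtype_nbhs (x : U) (B : set U) : nbhs x B ->
  exists2 Q, open_nbhs (oinc x) Q & oinc @^-1` Q `<=` B.
Proof.
by rewrite nbhsE => -[_ [[Q oQ <-] Qx] QB]; exists Q.
Qed.

Lemma continuous_into_subtype (T : topologicalType) (f : T -> U) x :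
  {for x, continuous (oinc \o f)} -> {for x, continuous f}.
Proof.
move=> cf B /open_subtype_nbhs[Q /open_nbhs_nbhs Qx QB].
by near=> y; apply: QB; near: y; exact: cf.
Unshelve. all: by end_near. Qed.

Lemma open_chart_img : open (oinc @` setT).
Proof. by rewrite image_val_setT. Qed.

Lemma open_chart_cancel : {in setT, cancel oinc oret}.
Proof. by move=> x _; exact: valKd. Qed.

Lemma open_chart_continuous : {within setT, continuous oinc}.
Proof. exact/continuous_subspaceT/continuous_val. Qed.

Lemma open_chart_inv_continuous :
  {within oinc @` setT, continuous oret}.
Proof.
rewrite image_val_setT continuous_open_subspace// => x; rewrite inE => Ux.
apply: continuous_into_subtype.
suff : oinc (oret y) @[y --> x] --> x by rewrite -{2}(oretK Ux).
have nx : \forall y \near x, y = oinc (oret y).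
  by near=> y; rewrite oretK//; near: y; exact: open_nbhs_nbhs.
exact: cvg_trans (near_eq_cvg nx) cvg_id.
Unshelve. all: by end_near. Qed.

Definition open_chart : chart R n U :=
  Chart openT open_chart_img open_chart_cancel open_chart_continuous
    open_chart_inv_continuous.

Lemma open_submanifold_hausdorff : hausdorff_space U.
Proof.
move=> x y xy; apply: val_inj; apply: norm_hausdorff => A B Ax By.
have [z [Az Bz]] := xy _ _ (continuous_val Ax) (continuous_val By).
by exists (oinc z).
Qed.

(** The traces on [U] of the balls with rational centre and radius 1/(N+1) form a countable
    basis. *)
Lemma open_submanifold_second_countable : @second_countable U.
Proof.
pose b (p : 'rV[rat]_n * nat) : set U :=
  oinc @^-1` (ball (map_mx ratr p.1 : 'rV[R]_n) p.2.+1%:R^-1).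
exists (range b).
  exact: sub_countable (card_image_le b setT) (countableP _).
split=> [_ [p _ <-]|x V /open_subtype_nbhs[Q [oQ Qx] QV]].
  by apply: open_comp => [y _|]; [exact: continuous_val|exact: ball_open].
have /nbhs_ballP[e /= e0 eQ] : nbhs (oinc x) Q by exact: open_nbhs_nbhs.
(* With 1/(N+1) < e/2, a ball of that radius that contains [x] lies in the ball of radius [e] around
   [x]. *)
have [N] := @ltr_add_invr R 0 (e / 2) (divr_gt0 e0 (ltr0n _ 2)).
rewrite add0r => Ne; have N0 : (0 : R) < N.+1%:R^-1 by rewrite invr_gt0.
have /choice[q qx] (j : 'I_n) : exists r : rat,
    `|oinc x 0 j - ratr r| < N.+1%:R^-1.
  have [|r] := @rat_in_itvoo R (oinc x 0 j) (oinc x 0 j + N.+1%:R^-1).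
    by rewrite ltrDl.
  rewrite in_itv/= => /andP[r1 r2]; exists r.
  rewrite ltr0_norm ?subr_lt0// opprB.
  by rewrite ltrBlDl.
have bx : ball (map_mx ratr (\row_j q j) : 'rV[R]_n) N.+1%:R^-1 (oinc x).
  split => // i j; rewrite !ord1 /ball/= !mxE distrC; exact: qx.
exists (b (\row_j q j, N)); first by split => //; exists (\row_j q j, N).
move=> y by_; apply: QV; apply: eQ; rewrite [e]splitr.
apply: ball_triangle; last exact: (le_ball (ltW Ne) by_).
by apply: ball_sym; exact: (le_ball (ltW Ne) bx).
Qed.

(** The transition map is junk outside [U]; being the identity near each point of [U] is what
    determines its derivatives there. *)
Lemma open_chart_transition x : U x -> \near x, (oinc \o oret) x = x.
Proof.
move=> Ux; near=> y; rewrite /= oretK//; near: y; exact: open_nbhs_nbhs.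
Unshelve. all: by end_near. Qed.

Lemma jacobian_near_id (f : 'rV[R]_n -> 'rV[R]_n) x :
  (\near x, f x = x) -> jacobian f x = 1%:M.
Proof.
move=> fx; apply/row_matrixP => i; rewrite !rowE mulmx1.
have df : differentiable f x.
  apply: (near_eq_differentiable (f := id)) => //.
  by near=> y; apply/esym; near: y.
rewrite -deriveEjacobian// (near_eq_derive (g := id))//.
exact: derive_id.
Unshelve. all: by end_near. Qed.

Lemma open_transition_smooth :
  smooth_on (oinc @` (setT `&` setT)) (oinc \o oret).
Proof.
rewrite setTI image_val_setT => k; apply: (Ck_on_eq (f := id)) => //.
  by move=> x Ux; rewrite /= oretK.
apply: (@Ck_on_linear _ _ _ _ _ id) => [//|x]; exact: cvg_id.
Qed.

Lemma open_transition_oriented x : (oinc @` (setT `&` setT)) x ->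
  0 < \det (jacobian (oinc \o oret) x).
Proof.
rewrite setTI image_val_setT => Ux.
by rewrite jacobian_near_id ?det1//; exact: open_chart_transition.
Qed.

Definition open_submanifold : oriented_manifold R n :=
  @OrientedManifold R n U open_submanifold_hausdorff
    open_submanifold_second_countable (fun=> open_chart) (fun=> I)
    (fun _ _ => open_transition_smooth)
    (fun _ _ => open_transition_oriented).

End OpenSubmanifold.

(** * Calculus of differentials of real-valued functions *)

Section HasDiff.
Variables (R : realType) (V : normedModType R).
Implicit Types (f g : V -> R) (x : V).

(** Differentiability and the formula for the derivative are bundled so that [has_diff_tac] finds
    both by following the syntax of [f]; [has_diff_eq] then replaces the raw formula by a readable
    one. *)
Definition has_diff f x (df : V -> R) : Prop :=
  differentiable f x /\ forall v, 'D_v f x = df v.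

Lemma has_diff_eq f x df dg :
  has_diff f x df -> (forall v, df v = dg v) -> has_diff f x dg.
Proof. by move=> [fx dfE] dfg; split=> // v; rewrite dfE. Qed.

Lemma has_diff_cst x (c : R) : has_diff (fun=> c) x (fun=> 0).
Proof.
by split => [|v]; [exact: differentiable_cst|exact: derive_cst].
Qed.

Lemma has_diffD f g x df dg : has_diff f x df -> has_diff g x dg ->
  has_diff (fun y => f y + g y) x (fun v => df v + dg v).
Proof.
move=> [fx dfE] [gx dgE]; split=> [|v]; first exact: differentiableD.
by rewrite deriveD ?dfE ?dgE//; exact: diff_derivable.
Qed.

Lemma has_diffN f x df : has_diff f x df ->
  has_diff (fun y => - f y) x (fun v => - df v).
Proof.
move=> [fx dfE]; split=> [|v]; first exact: differentiableN.
by rewrite deriveN ?dfE//; exact: diff_derivable.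
Qed.

Lemma has_diffM f g x df dg : has_diff f x df -> has_diff g x dg ->
  has_diff (fun y => f y * g y) x (fun v => f x * dg v + g x * df v).
Proof.
move=> [fx dfE] [gx dgE]; split=> [|v]; first exact: differentiableM.
by rewrite deriveM ?dfE ?dgE//; exact: diff_derivable.
Qed.

Lemma has_diff_sin f x df : has_diff f x df ->
  has_diff (fun y => sin (f y)) x (fun v => cos (f x) * df v).
Proof.
move=> [fx dfE]; split=> [|v]; last by rewrite derive_sin_comp ?dfE.
by apply: differentiable_comp => //; exact: differentiable_sin.
Qed.

Lemma has_diff_cos f x df : has_diff f x df ->
  has_diff (fun y => cos (f y)) x (fun v => - sin (f x) * df v).
Proof.
move=> [fx dfE]; split=> [|v]; last by rewrite derive_cos_comp ?dfE.
by apply: differentiable_comp => //; exact: differentiable_cos.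
Qed.

End HasDiff.

Lemma has_diff_coord (R : realType) n (x : 'rV[R]_n) j :
  has_diff (fun y : 'rV[R]_n => y 0 j) x (fun v => v 0 j).
Proof.
split=> [|v]; first exact: differentiable_coord.
have d : derivable (@id 'rV[R]_n) x v by exact: derivable_id.
by have := derive_mx d; rewrite derive_id => /matrixP/(_ 0 j); rewrite mxE.
Qed.

Lemma Ck_on_coord (R : realType) n k (D : set 'rV[R]_n) j :
  Ck_on k D (fun y : 'rV[R]_n => y 0 j).
Proof.
case: k => [x _|k]; first exact: coord_continuous.
split=> [x _|v]; first exact: differentiable_coord.
have -> : (fun x : 'rV[R]_n => 'D_v (fun y : 'rV[R]_n => y 0 j) x) =
    fun=> v 0 j.
  by apply/funext => x; exact: (has_diff_coord x j).2.
exact: Ck_on_cst.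
Qed.

Ltac has_diff_tac := repeat first
  [ exact: has_diff_coord | exact: has_diff_cst | apply: has_diffD
  | apply: has_diffN | apply: has_diffM | apply: has_diff_sin
  | apply: has_diff_cos ].

(** * The even contact structure on the product of two punctured planes *)

Section EvenContact.
Variable R : realType.
Implicit Types x v : 'rV[R]_4.

Definition row4 (a b c d : R) : 'rV[R]_4 := \row_j nth 0 [:: a; b; c; d] j.

Definition rsq1 x : R := x 0 k0 * x 0 k0 + x 0 k1 * x 0 k1.
Definition rsq2 x : R := x 0 k2 * x 0 k2 + x 0 k3 * x 0 k3.

Definition biannulus : set 'rV[R]_4 := [set x | 0 < rsq1 x /\ 0 < rsq2 x].

Lemma has_diff_rsq1 x :
  has_diff rsq1 x (fun v => 2 * (x 0 k0 * v 0 k0 + x 0 k1 * v 0 k1)).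
Proof.
eapply has_diff_eq; first by rewrite /rsq1; has_diff_tac.
by move=> v /=; ring.
Qed.

Lemma has_diff_rsq2 x :
  has_diff rsq2 x (fun v => 2 * (x 0 k2 * v 0 k2 + x 0 k3 * v 0 k3)).
Proof.
eapply has_diff_eq; first by rewrite /rsq2; has_diff_tac.
by move=> v /=; ring.
Qed.

Lemma biannulus_open : open biannulus.
Proof.
have c1 : continuous rsq1.
  by move=> x; apply: differentiable_continuous; exact: (has_diff_rsq1 x).1.
have c2 : continuous rsq2.
  by move=> x; apply: differentiable_continuous; exact: (has_diff_rsq2 x).1.
rewrite (_ : biannulus =
  rsq1 @^-1` [set r | 0 < r] `&` rsq2 @^-1` [set r | 0 < r]) //.
by apply: openI; [move/continuousP : c1|move/continuousP : c2]; apply;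
  exact: open_gt.
Qed.

Lemma biannulus_point : biannulus (row4 1 0 1 0).
Proof.
by rewrite /biannulus /rsq1 /rsq2 /= !mxE /= mulr1 mulr0 addr0; split.
Qed.

Definition biannulus_manifold : oriented_manifold R 4 :=
  open_submanifold biannulus_open (SigSub (mem_set biannulus_point)).

Definition alpha_coef x : seq R :=
  [:: (rsq1 x - 1) * x 0 k1;
      - ((rsq1 x - 1) * x 0 k0);
      2 * (rsq1 x * x 0 k2) + rsq1 x * sin (rsq2 x) * x 0 k3;
      2 * (rsq1 x * x 0 k3) - rsq1 x * sin (rsq2 x) * x 0 k2].

(* u dw - (u - 1) (x0 dx1 - x1 dx0) - u sin(w) (x2 dx3 - x3 dx2), where u and w
   are the squared radii [rsq1] and [rsq2]. *)
Definition alpha x : 'cV[R]_4 := \col_j nth 0 (alpha_coef x) j.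

Lemma pairing_alpha x v : pairing (alpha x) v =
  2 * rsq1 x * (x 0 k2 * v 0 k2 + x 0 k3 * v 0 k3)
  - (rsq1 x - 1) * (x 0 k0 * v 0 k1 - x 0 k1 * v 0 k0)
  - rsq1 x * sin (rsq2 x) * (x 0 k2 * v 0 k3 - x 0 k3 * v 0 k2).
Proof. by rewrite /pairing mxE !big_ord_recl big_ord0 !mxE /=; ring. Qed.

Lemma alpha_smooth : smooth_on biannulus alpha.
Proof.
move=> k; have oU := biannulus_open.
have cc j : Ck_on k biannulus (fun x => x 0 j : R) by exact: Ck_on_coord.
have cst (c : R) : Ck_on k biannulus (fun=> c) by exact: Ck_on_cst.
have c1 : Ck_on k biannulus rsq1 by apply: Ck_onD => //; apply: Ck_onM.
have c2 : Ck_on k biannulus rsq2 by apply: Ck_onD => //; apply: Ck_onM.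
have [cs _] := Ck_on_sincos oU c2.
have cm (f : 'rV[R]_4 -> R) : Ck_on k biannulus f ->
    Ck_on k biannulus (fun x => - f x).
  move=> cf; apply: (Ck_on_eq oU _ (Ck_onM oU (cst (-1)) cf)) => x _.
  by rewrite mulN1r.
have c1m : Ck_on k biannulus (fun x => rsq1 x - 1) by apply: Ck_onD.
apply: Ck_on_mx => // j i; rewrite (ord1 i).
pose c (j : nat) (x : 'rV[R]_4) := nth 0 (alpha_coef x) j.
apply: (Ck_on_eq oU (f := c j)); first by move=> x _; rewrite mxE.
case: j => [[|[|[|[|//]]]] ?]; rewrite /c /=.
- exact: Ck_onM.
- by apply: cm; exact: Ck_onM.
- by apply: Ck_onD => //; apply: Ck_onM => //; apply: Ck_onM.
- by apply: Ck_onD => //; [|apply: cm]; apply: Ck_onM => //; apply: Ck_onM.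
Qed.

Definition alphaM : one_form biannulus_manifold := fun p => alpha (\val p).

Lemma in_chart_alphaM (q : biannulus_manifold) x : biannulus x ->
  in_chart alphaM q x = alpha x.
Proof.
move=> Ux; rewrite /in_chart /=.
rewrite (jacobian_near_id (open_chart_transition biannulus_open _ Ux)) mul1mx.
by rewrite /alphaM oretK.
Qed.

Definition dalpha x v w : R :=
  'D_v (fun y => pairing (alpha y) w) x - 'D_w (fun y => pairing (alpha y) v) x.

Lemma ext_deriv_alphaM (p : biannulus_manifold) v w :
  ext_deriv alphaM p v w = dalpha (\val p) v w.
Proof.
have Up : biannulus (\val p) by exact: set_valP.
have near_alpha u : \forall y \near (\val p : 'rV[R]_4),
    pairing (in_chart alphaM p y) u = pairing (alpha y) u.
  near=> y; rewrite in_chart_alphaM//; near: y.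
  exact: open_nbhs_nbhs (conj biannulus_open Up).
by rewrite /ext_deriv /dalpha /=; congr (_ - _); exact: near_eq_derive.
Unshelve. all: by end_near. Qed.

(** As [u] is constant, this gives both terms of [dalpha]; [dr1] and [dr2] are the differentials of
    the squared radii. *)
Lemma has_diff_pairing_alpha x u :
  has_diff (fun y => pairing (alpha y) u) x (fun v =>
    let dr1 := 2 * (x 0 k0 * v 0 k0 + x 0 k1 * v 0 k1) in
    let dr2 := 2 * (x 0 k2 * v 0 k2 + x 0 k3 * v 0 k3) in
    2 * (dr1 * (x 0 k2 * u 0 k2 + x 0 k3 * u 0 k3)
         + rsq1 x * (v 0 k2 * u 0 k2 + v 0 k3 * u 0 k3))
    - (dr1 * (x 0 k0 * u 0 k1 - x 0 k1 * u 0 k0)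
       + (rsq1 x - 1) * (v 0 k0 * u 0 k1 - v 0 k1 * u 0 k0))
    - ((dr1 * sin (rsq2 x) + rsq1 x * cos (rsq2 x) * dr2)
         * (x 0 k2 * u 0 k3 - x 0 k3 * u 0 k2)
       + rsq1 x * sin (rsq2 x) * (v 0 k2 * u 0 k3 - v 0 k3 * u 0 k2))).
Proof.
eapply has_diff_eq.
  under [f in has_diff f]eq_fun do rewrite pairing_alpha.
  repeat first
    [exact: has_diff_rsq1 | exact: has_diff_rsq2 | progress has_diff_tac].
by move=> v /=; ring.
Qed.

Lemma wedge_alpha_neq0 (p : biannulus_manifold) :
  exists u v w, wedge_da alphaM p u v w != 0.
Proof.
set x : 'rV[R]_4 := \val p; have [u0 w0] : biannulus x by exact: set_valP.
(* The radial and angular fields of the first plane, and the radial field of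
   the second one. *)
pose X1 := row4 (x 0 k0) (x 0 k1) 0 0.
pose T1 := row4 (- x 0 k1) (x 0 k0) 0 0.
pose X2 := row4 0 0 (x 0 k2) (x 0 k3).
exists X1, T1, X2; rewrite /wedge_da !ext_deriv_alphaM -/x.
(* The value comes from writing the form as u b with b = dz - y dx - f(z) dtheta, so that its wedge
   with its derivative is u^2 b db. All three fields are killed by dtheta, and b db takes on them
   the value dw(X2) times - du(X1) dx(T1), that is 2 w times - 2 u. *)
have -> : pairing (alphaM p) X1 * dalpha x T1 X2 +
    pairing (alphaM p) T1 * dalpha x X2 X1 +
    pairing (alphaM p) X2 * dalpha x X1 T1 = - 4 * rsq1 x ^+ 3 * rsq2 x.
  rewrite /dalpha !(has_diff_pairing_alpha _ _).2 /alphaM -/x !pairing_alpha.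
  rewrite !mxE /=; set s := sin _; set c := cos _; rewrite /rsq1 /rsq2; ring.
have n4 : - 4 != 0 :> R by lra.
by rewrite !mulf_neq0 ?expf_neq0//; exact: lt0r_neq0.
Qed.

(** An element of ['Hom], so that [lker] provides the distribution as a vector space and
    rank-nullity applies. *)
Definition alpha_form x : 'Hom('rV[R]_4, 'M[R]_1) :=
  linfun (mulmxr (alpha x)).

Lemma mem_ker_alpha x v : v \in lker (alpha_form x) <-> pairing (alpha x) v = 0.
Proof.
rewrite memv_ker lfunE /pairing /=; split => [/eqP->|vx]; first by rewrite mxE.
by apply/eqP/matrixP => i j; rewrite !ord1 vx mxE.
Qed.

(** By rank-nullity it suffices that the form be nonzero, and its value on the radial field of the
    second plane is 2 u w. *)
Lemma dim_ker_alpha x : biannulus x -> \dim (lker (alpha_form x)) = 3%N.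
Proof.
move=> [u0 w0]; have := limg_ker_dim (alpha_form x) fullv.
rewrite capfv dimvf /dim /= => dimE.
suff d1 : \dim (limg (alpha_form x)) = 1%N.
  by move: dimE; rewrite d1 addn1 mul1n => -[].
apply/eqP; rewrite eqn_leq; apply/andP; split.
  by rewrite (leq_trans (dimvS (subvf _)))// dimvf.
rewrite lt0n dimv_eq0; apply/negP => /eqP img0.
pose X2 := row4 0 0 (x 0 k2) (x 0 k3).
have : alpha_form x X2 \in limg (alpha_form x) by exact/memv_img/memvf.
rewrite img0 memv0 => /eqP aX2.
have : pairing (alpha x) X2 = 0 by apply/mem_ker_alpha; rewrite memv_ker aX2.
rewrite pairing_alpha !mxE /= !mulr0 => H.
have : 2 * rsq1 x * rsq2 x = 0 by rewrite -H /rsq1 /rsq2; ring.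
by apply/eqP; rewrite !mulf_neq0 ?lt0r_neq0.
Qed.

Lemma alphaM_local (p : biannulus_manifold) :
  exists (V : set biannulus_manifold) (a : one_form biannulus_manifold),
  [/\ open V, V p, smooth_form_on V a & forall q, V q ->
    [/\ forall v, v \in lker (alpha_form (\val q)) <-> pairing (a q) v = 0,
        forall v, [set v | 0 < pairing (alphaM q) v] v <-> 0 < pairing (a q) v &
        exists u v w, wedge_da a q u v w != 0]].
Proof.
exists setT, alphaM; split => //; first exact: openT.
  move=> q k; rewrite setTI image_val_setT; have oU := biannulus_open.
  apply: (Ck_on_eq oU _ (alpha_smooth k)) => x Ux.
  by rewrite in_chart_alphaM.
by move=> q _; split=> // [v|]; [exact: mem_ker_alpha|exact: wedge_alpha_neq0].
Qed.

Definition biannulus_contact : even_contact biannulus_manifold :=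
  @EvenContact R biannulus_manifold (fun p => lker (alpha_form (\val p)))
    (fun p => [set v | 0 < pairing (alphaM p) v])
    (fun p => dim_ker_alpha (set_valP p)) alphaM_local.

End EvenContact.

(** * The Legendrian tori and the smooth isotopies between them *)

Lemma eq_mulmxr (R : pzRingType) m n (A B : 'M[R]_(m, n)) :
  (forall v : 'rV_m, v *m A = v *m B) -> A = B.
Proof. by move=> AB; apply/row_matrixP => i; rewrite !rowE AB. Qed.

Section Tori.
Variable R : realType.
Local Notation M := (biannulus_manifold R).
Implicit Types (r : R) (s t v : 'rV[R]_2).

Local Notation tau := (2 * pi : R).

Lemma ord2 (j : 'I_2) : j = j0 \/ j = j1.
Proof. by case: j => [[|[|//]] ?]; [left|right]; exact: val_inj. Qed.

Lemma cos_sin_2pi_int (x : R) (k : int) :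
  cos (tau * (x + k%:~R)) = cos (tau * x) /\
  sin (tau * (x + k%:~R)) = sin (tau * x).
Proof.
have E (n : nat) y : tau * (y + n%:R) = tau * y + (pi *+ 2) *+ n.
  by rewrite mulrDr mulr_natr mulr_natl.
have [pc ps] := (periodicn (@cosD2pi R), periodicn (@sinD2pi R)).
case: k => n; first by rewrite -[(Posz n)%:~R]/(n%:R) E pc ps.
have -> : tau * x = tau * (x + (Negz n)%:~R) + (pi *+ 2) *+ n.+1.
  by rewrite -E NegzE mulrNz subrK.
by rewrite pc ps.
Qed.

(** For the fractional part y of [x], the double angle formula gives sin(pi y) = 0, whereas the sine
    is positive on the open interval from 0 to pi. *)
Lemma cos_2pi_eq1 (x : R) : cos (tau * x) = 1 -> exists k : int, x = k%:~R.
Proof.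
move=> cx; exists (Num.floor x); apply/eqP; rewrite -subr_eq0.
set y := x - _; have y0 : 0 <= y by rewrite subr_ge0 floor_le.
have y1 : y < 1.
  by rewrite ltrBlDl (lt_le_trans (floorD1_gt x))// intrD addrC.
have cy : cos (tau * y) = 1.
  by rewrite -(cos_sin_2pi_int y (Num.floor x)).1 /y subrK.
have : cos ((pi * y) *+ 2) = 1 by rewrite -mulr_natl mulrA.
rewrite cos_mulr2n cos2sin2 => sy.
have /eqP : sin (pi * y) ^+ 2 = 0 by lra.
rewrite sqrf_eq0; apply: contraLR => yn0.
have yp : 0 < y by rewrite lt_def yn0.
by rewrite gt_eqF// sin_gt0_pi// mulr_gt0 ?pi_gt0//= gtr_pMr ?pi_gt0.
Qed.

Lemma cos_sin_2pi_eq (x y : R) : cos (tau * x) = cos (tau * y) ->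
  sin (tau * x) = sin (tau * y) -> exists k : int, x - y = k%:~R.
Proof.
move=> cxy sxy; apply: cos_2pi_eq1.
by rewrite mulrBr cosB cxy sxy -!expr2 cos2Dsin2.
Qed.

(** The first circle has radius 1, which means y = 0, and the second one has radius [r], which means
    z = r^2. *)
Definition torus_pt r s : 'rV[R]_4 :=
  row4 (cos (tau * s 0 j0)) (sin (tau * s 0 j0))
       (r * cos (tau * s 0 j1)) (r * sin (tau * s 0 j1)).

Lemma rsq1_torus r s : rsq1 (torus_pt r s) = 1.
Proof. by rewrite /rsq1 !mxE /= -!expr2 cos2Dsin2. Qed.

Lemma rsq2_torus r s : rsq2 (torus_pt r s) = r ^+ 2.
Proof.
rewrite /rsq2 !mxE /= -!expr2 !exprMn -mulrDr.
by rewrite cos2Dsin2 mulr1.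
Qed.

(** For [r] = 0 the point leaves [biannulus] and [insubd] returns its default, hence the hypothesis
    [r != 0] below. *)
Definition torus r s : M :=
  insubd (SigSub (mem_set (biannulus_point R)) : M) (torus_pt r s).

Lemma val_torus r s : r != 0 -> \val (torus r s) = torus_pt r s.
Proof.
move=> r0; apply: insubdK; apply/mem_set; split.
  by rewrite rsq1_torus.
by rewrite rsq2_torus exprn_even_gt0.
Qed.

Lemma smooth_map_biannulus (V : normedModType R) (f : V -> M) :
  smooth_on setT (fun x => \val (f x)) -> smooth_map f.
Proof.
move=> sf; split=> [x|q]; last exact: sf.
by apply: (continuous_into_subtype (U := @biannulus R)); exact: (sf 0%N x I).
Qed.

(** Radius and angles depend on an arbitrary parameter, in order to treat at once a single torus and
    an isotopy in which the radius varies. *)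
Lemma smooth_torus_family (V : normedModType R) (r a b : V -> R) (f : V -> M) :
  (forall x, \val (f x) =
    row4 (cos (a x)) (sin (a x)) (r x * cos (b x)) (r x * sin (b x))) ->
  smooth_on setT r -> smooth_on setT a -> smooth_on setT b -> smooth_map f.
Proof.
move=> fE sr sa sb; apply: smooth_map_biannulus => k; have oT := @openT V.
have [csa cca] := Ck_on_sincos oT (sa k).
have [csb ccb] := Ck_on_sincos oT (sb k).
apply: (Ck_on_eq oT (f := fun x => row4 (cos (a x)) (sin (a x))
  (r x * cos (b x)) (r x * sin (b x)))) => [x _|]; first by rewrite fE.
apply: Ck_on_mx => // i j.
pose c (j : nat) x := nth 0 [:: cos (a x); sin (a x); r x * cos (b x);
  r x * sin (b x)] j.
apply: (Ck_on_eq oT (f := c j)); first by move=> x _; rewrite mxE.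
by case: j => [[|[|[|[|//]]]] ?]; rewrite /c //=; exact: Ck_onM.
Qed.

Lemma torus_smooth r : r != 0 -> smooth_map (torus r).
Proof.
move=> r0; have cc j k : Ck_on k setT (fun s => tau * s 0 j).
  apply: (Ck_onM (f := fun=> tau)); first exact: openT.
    exact: Ck_on_cst.
  exact: Ck_on_coord.
apply: (smooth_torus_family (fun s => val_torus s r0)) => k //.
exact: Ck_on_cst.
Qed.

Lemma torus_injective r s t : r != 0 -> torus r s = torus r t <->
  exists k : 'rV[int]_2, s - t = map_mx (fun z : int => z%:~R) k.
Proof.
move=> r0; split=> [st|[k stk]].
  have /matrixP E : torus_pt r s = torus_pt r t by rewrite -!val_torus// st.
  have := (E 0 k0, E 0 k1, E 0 k2, E 0 k3).
  rewrite !mxE /= => -[[[c0 s0] c1] s1].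
  have [a ha] := cos_sin_2pi_eq c0 s0.
  have [b hb] := cos_sin_2pi_eq (mulfI r0 c1) (mulfI r0 s1).
  exists (\row_j (if j == j0 then a else b)); apply/rowP => j; rewrite !mxE.
  by case: (ord2 j) => -> /=; [rewrite -ha|rewrite -hb].
have tE j : s 0 j = t 0 j + (k 0 j)%:~R.
  by move/rowP : stk => /(_ j); rewrite !mxE => <-; rewrite subrKC.
rewrite /torus /torus_pt !tE.
by rewrite !(cos_sin_2pi_int _ _).1 !(cos_sin_2pi_int _ _).2.
Qed.

(** The derivative is a combination of the two rotation fields at the point [p]. Expressing it
    through [p] and not through the angles shows that it is the same at all parameters of the same
    point. *)
Lemma derive_torus_pt r s v : differentiable (torus_pt r) s /\
  'D_v (torus_pt r) s = let p := torus_pt r s in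
  row4 (- (tau * v 0 j0 * p 0 k1)) (tau * v 0 j0 * p 0 k0)
       (- (tau * v 0 j1 * p 0 k3)) (tau * v 0 j1 * p 0 k2).
Proof.
pose c (j : nat) s := nth 0 [:: cos (tau * s 0 j0); sin (tau * s 0 j0);
  r * cos (tau * s 0 j1); r * sin (tau * s 0 j1)] j.
have cE (j : 'I_4) : (fun s => torus_pt r s 0 j) = c j.
  by apply/funext => u; rewrite mxE.
pose p := torus_pt r s.
have D (j : 'I_4) : has_diff (c j) s (fun v => nth 0
  [:: - (tau * v 0 j0 * p 0 k1); tau * v 0 j0 * p 0 k0;
      - (tau * v 0 j1 * p 0 k3); tau * v 0 j1 * p 0 k2] j).
  by case: j => [[|[|[|[|//]]]] ?]; rewrite /c /p /=;
    (eapply has_diff_eq; first has_diff_tac) => u; rewrite !mxE /=; ring.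
have d : differentiable (torus_pt r) s.
  by apply: differentiable_mx => i j; rewrite (ord1 i) cE; exact: (D j).1.
split => //=; apply/rowP => j; rewrite derive_coord// cE (D j).2.
by rewrite [RHS]mxE.
Qed.

Lemma tangent_torus r s v : r != 0 -> v *m tangent_mx (torus r) s =
  let p := \val (torus r s) : 'rV[R]_4 in
  row4 (- (tau * v 0 j0 * p 0 k1)) (tau * v 0 j0 * p 0 k0)
       (- (tau * v 0 j1 * p 0 k3)) (tau * v 0 j1 * p 0 k2).
Proof.
move=> r0; rewrite val_torus// -(derive_torus_pt _ _ _).2.
rewrite (deriveEjacobian _ (derive_torus_pt _ _ v).1) /tangent_mx /=.
congr (_ *m jacobian _ _); apply/funext => t /=.
exact: val_torus.
Qed.

Lemma embedded_torus_torus r : r != 0 -> embedded_torus (torus r).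
Proof.
move=> r0; split => [|s t|s]; [exact: torus_smooth|exact: torus_injective|].
apply/eqP; apply: inj_row_free => v; rewrite tangent_torus// val_torus//.
have tau0 : tau != 0 by rewrite mulf_neq0// gt_eqF// pi_gt0.
move/rowP => E; have := (E k0, E k1, E k2, E k3); rewrite !mxE /=.
set a := tau * s 0 j0; set b := tau * s 0 j1 => -[[[e0 e1] e2] e3].
(* The pairing of the first two components with the unit vector (- sin a, cos a) recovers this
   coordinate; the last two components are treated alike, up to the factor [r]. *)
have v0 : tau * v 0 j0 = 0.
  suff -> : tau * v 0 j0 = tau * v 0 j0 * cos a * cos a
      - - (tau * v 0 j0 * sin a) * sin a by rewrite e0 e1; ring.
  by rewrite -[LHS]mulr1 -(cos2Dsin2 a); ring.
have v1 : tau * v 0 j1 = 0.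
  apply: (mulfI r0); rewrite mulr0.
  suff -> : r * (tau * v 0 j1) = tau * v 0 j1 * (r * cos b) * cos b
      - - (tau * v 0 j1 * (r * sin b)) * sin b by rewrite e2 e3; ring.
  by rewrite -[LHS]mulr1 -(cos2Dsin2 b); ring.
apply/rowP => j; rewrite mxE.
move/eqP : v0; rewrite mulf_eq0 (negPf tau0) => /eqP v0.
move/eqP : v1; rewrite mulf_eq0 (negPf tau0) => /eqP v1.
by case: (ord2 j) => ->.
Qed.

(** Each of the three terms of the form vanishes on the torus: [rsq2] is constant, [rsq1] is 1, and
    sin(r^2) = 0. *)
Lemma torus_legendrian r : r != 0 -> sin (r ^+ 2) = 0 ->
  legendrian_torus (biannulus_contact R) (torus r).
Proof.
move=> r0 sr; split=> [|s v]; first exact: embedded_torus_torus.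
apply/mem_ker_alpha; rewrite tangent_torus// pairing_alpha val_torus//.
rewrite rsq1_torus rsq2_torus sr !mxE /=; ring.
Qed.

(** Two parameters of the same point may differ by a period, but the tangent matrix depends only on
    the point, so the identity is a valid change of basis. *)
Lemma same_oriented_torus_refl r : r != 0 ->
  same_oriented_torus (torus r) (torus r).
Proof.
move=> r0; split => // s t st.
have E : tangent_mx (torus r) s = tangent_mx (torus r) t.
  apply: eq_mulmxr => v.
  apply: etrans (tangent_torus s v r0) _; apply/esym.
  by apply: etrans (tangent_torus t v r0) _; rewrite -st.
have d1 : 0 < \det (1%:M : 'M[R]_2) by rewrite det1 ltr01.
by exists (1%:M : 'M[R]_2); [exact: d1|rewrite mul1mx; exact: E].
Qed.

Lemma torus_isotopic (a b : R) : 0 < a -> 0 < b ->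
  smoothly_isotopic (torus a) (torus b).
Proof.
move=> a0 b0.
(* The homotopy has all of R as its time interval, and an affine interpolation between distinct
   radii would vanish at some time; this quadratic one is positive everywhere. *)
pose rho (t : R) := a * ((1 - t) * (1 - t)) + b * (t * t).
have rho0 (x : R) : rho x != 0.
  rewrite gt_eqF// /rho -!expr2; have := sqr_ge0 (1 - x).
  have [->|x0] := eqVneq x 0.
    by rewrite subr0 expr0n expr1n mulr0 addr0 mulr1.
  have : 0 < x ^+ 2 by rewrite exprn_even_gt0.
  nra.
have [rho_0 rho_1] : rho 0 = a /\ rho 1 = b by rewrite /rho; split; ring.
exists (fun p => torus (rho p.1) p.2); split.
- have oT := @openT (R * 'rV[R]_2)%type.
  have cst (c : R) k : Ck_on k setT (fun _ : R * 'rV[R]_2 => c).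
    exact: Ck_on_cst.
  have c1 k : Ck_on k setT (fun p : R * 'rV[R]_2 => p.1).
    by apply: Ck_on_linear => // x; exact: cvg_fst.
  have c2 j k : Ck_on k setT (fun p : R * 'rV[R]_2 => p.2 0 j).
    apply: Ck_on_linear => [u x y|x]; first by rewrite /= !mxE.
    apply: (@continuous_comp _ _ _ snd (fun s : 'rV[R]_2 => s 0 j)).
      exact: cvg_snd.
    exact: coord_continuous.
  have cd k : Ck_on k setT (fun p : R * 'rV[R]_2 => 1 - p.1).
    have CN := Ck_onM oT (cst (-1) k) (c1 k).
    apply: (Ck_on_eq oT _ (Ck_onD oT (cst 1 k) CN)) => x _.
    by rewrite mulN1r.
  apply: (smooth_torus_family (fun p => val_torus p.2 (rho0 p.1))) => k.
  + apply: Ck_onD => //; apply: Ck_onM => //; exact: Ck_onM.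
  + exact: Ck_onM.
  + exact: Ck_onM.
- by move=> t _ /=; exact: (embedded_torus_torus (rho0 t)).
- by rewrite /= rho_0; apply: same_oriented_torus_refl; exact: lt0r_neq0.
- by rewrite /= rho_1; apply: same_oriented_torus_refl; exact: lt0r_neq0.
Qed.

End Tori.

(** * Rigidity of Legendrian tori on which the two angular forms are independent *)

Section Rigidity.
Variable R : realType.
Implicit Types (s v : 'rV[R]_2) (x y z : 'rV[R]_4).

Lemma derive_at_max (V : normedModType R) (f : V -> R) (m v : V) :
  (forall u, differentiable f u) -> (forall u, f u <= f m) -> 'D_v f m = 0.
Proof.
(* The restriction of [f] to the line through [m] directed by [v] has an interior maximum at 0. *)
move=> df fm; pose phi (h : R) := f (h *: v + m).
have dphi h : derivable phi h 1.
  have da : differentiable (fun h : R => h *: v + m) h.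
    apply: differentiableD; last exact: differentiable_cst.
    exact: differentiableZl.
  exact: diff_derivable (differentiable_comp da (df _)).
have -> : 'D_v f m = 'D_1 phi 0.
  rewrite /derive; congr lim; apply: (congr1 (fun g => g @ 0^')).
  by apply/funext => h; rewrite /phi /= addr0 scale0r add0r [h *: 1]mulr1.
have N11 : -1 <= 1 :> R by lra.
have c0 : (0 : R) \in (`](-1), 1[ : interval R).
  by rewrite in_itv/= ltrN10 ltr01.
have max0 t : t \in (`](-1), 1[ : interval R) -> phi t <= phi 0.
  by move=> _; rewrite /phi scale0r add0r.
have D0 := derive1_at_max N11 (fun t _ => dphi t) c0 max0.
by rewrite derive_val.
Qed.

Lemma derive_at_min (V : normedModType R) (f : V -> R) (m v : V) :
  (forall u, differentiable f u) -> (forall u, f m <= f u) -> 'D_v f m = 0.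
Proof.
move=> df fm; apply: oppr_inj.
rewrite oppr0 -deriveN; last exact: diff_derivable.
by apply: derive_at_max => u; [exact: differentiableN|rewrite lerN2].
Qed.

Lemma row2_kernel (a b c d : R) : a * d = b * c -> exists v,
  [/\ v != 0, v 0 j0 * a + v 0 j1 * c = 0 & v 0 j0 * b + v 0 j1 * d = 0].
Proof.
move=> ad; pose w (p q : R) : 'rV[R]_2 := \row_j (if j == j0 then p else q).
have wE p q : (w p q 0 j0 = p) * (w p q 0 j1 = q) by rewrite !mxE.
have w0 p q : w p q = 0 -> p = 0 /\ q = 0.
  by move=> wpq; rewrite -(wE p q).1 -{2}(wE p q).2 wpq !mxE.
(* By the vanishing of the determinant, (c, -a) and (d, -b) both solve the system; if both are zero,
   so is the matrix, and (1, 0) will do. *)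
have [/w0[c0 a0]|n] := eqVneq (w c (- a)) 0; last first.
  by exists (w c (- a)); rewrite !wE; split => //; lra.
have {}a0 : a = 0 by lra.
have [/w0[d0 b0]|n] := eqVneq (w d (- b)) 0; last first.
  by exists (w d (- b)); rewrite !wE; split => //; rewrite ?a0 ?c0; ring.
exists (w 1 0); rewrite !wE a0 c0; split; [|ring|lra].
by apply/negP => /eqP/w0[] /eqP; rewrite oner_eq0.
Qed.

Lemma derive_row2 (W : normedModType R) (g : 'rV[R]_2 -> W) s v :
  differentiable g s -> 'D_v g s = v 0 j0 *: 'D_e0 g s + v 0 j1 *: 'D_e1 g s.
Proof.
move=> dg; rewrite !deriveE// -!linearZ/= -linearD/=; congr ('d g s _).
by rewrite [LHS]row_sum_delta !big_ord_recl big_ord0 addr0.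
Qed.

(* Up to positive factors, [ang1] and [ang2] are the angular forms of the two
   planes at x, evaluated on y, and [jac2] is their wedge product. *)
Definition ang1 x y : R := x 0 k0 * y 0 k1 - x 0 k1 * y 0 k0.
Definition ang2 x y : R := x 0 k2 * y 0 k3 - x 0 k3 * y 0 k2.
Definition jac2 x y z : R := ang1 x y * ang2 x z - ang2 x y * ang1 x z.

Lemma ang1_row2 x y z (a b : R) :
  ang1 x (a *: y + b *: z) = a * ang1 x y + b * ang1 x z.
Proof. by rewrite /ang1 !mxE; ring. Qed.

Lemma ang2_row2 x y z (a b : R) :
  ang2 x (a *: y + b *: z) = a * ang2 x y + b * ang2 x z.
Proof. by rewrite /ang2 !mxE; ring. Qed.

Lemma row4_eq0 y :
  y 0 k0 = 0 -> y 0 k1 = 0 -> y 0 k2 = 0 -> y 0 k3 = 0 -> y = 0.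
Proof.
move=> y0 y1 y2 y3; apply/rowP => j; rewrite mxE.
have [->//|[->//|[->//|->//]]] : j = k0 \/ j = k1 \/ j = k2 \/ j = k3.
case: j => [[|[|[|[|//]]]] ?].
- by left; exact: val_inj.
- by right; left; exact: val_inj.
- by right; right; left; exact: val_inj.
- by right; right; right; exact: val_inj.
Qed.

(** The vector (a, b) and its rotation by a right angle form an orthogonal basis, and the hypotheses
    make (c, d) orthogonal to both. *)
Lemma planar_eq0 (a b c d : R) : a * a + b * b != 0 ->
  a * c + b * d = 0 -> a * d - b * c = 0 -> c = 0 /\ d = 0.
Proof.
move=> n0 E1 E2; split; apply: (mulfI n0); rewrite mulr0.
  have -> : (a * a + b * b) * c = a * (a * c + b * d) - b * (a * d - b * c).
    by ring.
  by rewrite E1 E2; ring.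
have -> : (a * a + b * b) * d = b * (a * c + b * d) + a * (a * d - b * c).
  by ring.
by rewrite E1 E2; ring.
Qed.

Lemma cramer2_eq0 (A B a b c d : R) : a * d - b * c != 0 ->
  A * a + B * b = 0 -> A * c + B * d = 0 -> A = 0 /\ B = 0.
Proof.
move=> n0 E0 E1; split; apply: (mulIf n0); rewrite mul0r.
  have -> : A * (a * d - b * c) = d * (A * a + B * b) - b * (A * c + B * d).
    by ring.
  by rewrite E0 E1; ring.
have -> : B * (a * d - b * c) = a * (A * c + B * d) - c * (A * a + B * b).
  by ring.
by rewrite E0 E1; ring.
Qed.

Lemma ang_radial_eq0 x y : rsq1 x != 0 -> rsq2 x != 0 ->
  ang1 x y = 0 -> ang2 x y = 0 ->
  x 0 k0 * y 0 k0 + x 0 k1 * y 0 k1 = 0 ->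
  x 0 k2 * y 0 k2 + x 0 k3 * y 0 k3 = 0 -> y = 0.
Proof.
move=> u0 w0 A1 A2 R1 R2.
have [y0 y1] := planar_eq0 u0 R1 A1; have [y2 y3] := planar_eq0 w0 R2 A2.
exact: row4_eq0.
Qed.

Section Torus.
Variable g : 'rV[R]_2 -> 'rV[R]_4.
Hypothesis dg : forall s, differentiable g s.

Lemma has_diff_comp_coord s j :
  has_diff (fun s => g s 0 j) s (fun v => ('D_v g s) 0 j).
Proof.
split=> [|v]; last by rewrite derive_coord.
apply: (@differentiable_comp _ _ _ _ g (fun x => x 0 j)) => //.
exact: differentiable_coord.
Qed.

Lemma has_diff_comp_rsq1 s : has_diff (fun s => rsq1 (g s)) s
  (fun v => 2 * (g s 0 k0 * ('D_v g s) 0 k0 + g s 0 k1 * ('D_v g s) 0 k1)).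
Proof.
eapply has_diff_eq.
  by apply: has_diffD; apply: has_diffM; exact: has_diff_comp_coord.
by move=> v /=; ring.
Qed.

Lemma has_diff_comp_rsq2 s : has_diff (fun s => rsq2 (g s)) s
  (fun v => 2 * (g s 0 k2 * ('D_v g s) 0 k2 + g s 0 k3 * ('D_v g s) 0 k3)).
Proof.
eapply has_diff_eq.
  by apply: has_diffD; apply: has_diffM; exact: has_diff_comp_coord.
by move=> v /=; ring.
Qed.

(** As both squared radii are constant, tangent vectors have no radial part. One that is killed by
    both angular forms is therefore zero, and the immersion hypothesis leaves no room for a
    dependence. *)
Lemma jac2_neq0 (a b : R) s : 0 < a -> 0 < b ->
  (forall s, rsq1 (g s) = a) -> (forall s, rsq2 (g s) = b) ->
  (forall v, 'D_v g s = 0 -> v = 0) -> jac2 (g s) ('D_e0 g s) ('D_e1 g s) != 0.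
Proof.
move=> a0 b0 ga gb imm; apply/eqP => /eqP; rewrite subr_eq0 => /eqP.
move=> /row2_kernel[v [vn0 A1 A2]]; move/eqP : vn0; apply; apply: imm.
have dv := derive_row2 v (dg s).
apply: (@ang_radial_eq0 (g s)).
- by rewrite ga lt0r_neq0.
- by rewrite gb lt0r_neq0.
- by apply: etrans A1; rewrite dv; exact: ang1_row2.
- by apply: etrans A2; rewrite dv; exact: ang2_row2.
- have [_ /(_ v)] := has_diff_comp_rsq1 s.
  rewrite (_ : (fun s => _) = cst a); last exact/funext.
  by rewrite derive_cst => /esym/eqP; rewrite mulf_eq0 pnatr_eq0 => /eqP.
- have [_ /(_ v)] := has_diff_comp_rsq2 s.
  rewrite (_ : (fun s => _) = cst b); last exact/funext.
  by rewrite derive_cst => /esym/eqP; rewrite mulf_eq0 pnatr_eq0 => /eqP.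
Qed.

Hypothesis gU : forall s, biannulus (g s).
Hypothesis legendrian : forall s v, pairing (alpha (g s)) ('D_v g s) = 0.

(** Where the differential of [rsq2] vanishes, the Legendrian condition becomes a linear relation
    between the two angular forms on the tangent plane. As these are independent there, both
    coefficients are zero. *)
Lemma legendrian_critical s :
  jac2 (g s) ('D_e0 g s) ('D_e1 g s) != 0 ->
  (forall v, 'D_v (fun s => rsq2 (g s)) s = 0) ->
  rsq1 (g s) = 1 /\ sin (rsq2 (g s)) = 0.
Proof.
move=> jn0 crit; have [u0 _] := gU s.
have E v : (rsq1 (g s) - 1) * ang1 (g s) ('D_v g s) +
    rsq1 (g s) * sin (rsq2 (g s)) * ang2 (g s) ('D_v g s) = 0.
  have := crit v; rewrite (has_diff_comp_rsq2 s).2 => c.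
  have := legendrian s v; rewrite pairing_alpha -/(ang1 _ _) -/(ang2 _ _).
  have -> : 2 * rsq1 (g s) *
    (g s 0 k2 * ('D_v g s) 0 k2 + g s 0 k3 * ('D_v g s) 0 k3) = 0.
    by rewrite mulrAC c mul0r.
  by move=> H; rewrite -[RHS]oppr0 -H; ring.
have [A0 B0] := cramer2_eq0 jn0 (E e0) (E e1).
split; first by apply/eqP; rewrite -subr_eq0 A0.
by move/eqP : B0; rewrite mulf_eq0 gt_eqF//= => /eqP.
Qed.

Definition unit_square : set 'rV[R]_2 :=
  [set s | forall i, [set` `[0, 1]] (s 0 i)].

Lemma unit_square_compact : compact unit_square.
Proof.
apply: (@rV_compact R 2 (fun=> [set` `[0, 1]])) => _.
exact: segment_compact.
Qed.

Hypothesis periodic : forall s (k : 'rV[int]_2),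
  g (s - map_mx (fun z : int => z%:~R) k) = g s.

Lemma periodic_square s : exists2 s', unit_square s' & g s' = g s.
Proof.
exists (s - map_mx (fun z : int => z%:~R) (\row_i Num.floor (s 0 i))).
  move=> i; rewrite /= in_itv/= !mxE subr_ge0 floor_le/=.
  by rewrite lerBlDl (le_trans (ltW (floorD1_gt _)))// intrD addrC.
exact: periodic.
Qed.

(** By periodicity [rsq2] attains its extrema over the plane in the unit square. They are critical
    values, hence zeros of the sine near [c], hence equal to [c]. So [rsq2] is constant, every point
    is critical, and [rsq1] is 1 everywhere. The nondegeneracy and closeness conditions are stated
    on the compact square so that they persist for nearby times. *)
Lemma legendrian_rigid (c : R) :
  (forall w, `|w - c| < pi -> sin w = 0 -> w = c) -> sin c = 0 ->
  (forall s, unit_square s -> jac2 (g s) ('D_e0 g s) ('D_e1 g s) != 0 /\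
    `|rsq2 (g s) - c| < pi) ->
  forall s, rsq1 (g s) = 1 /\ rsq2 (g s) = c.
Proof.
move=> isolated sc near_c.
have df s : differentiable (fun s => rsq2 (g s)) s.
  exact: (has_diff_comp_rsq2 s).1.
have crit s : unit_square s ->
    (forall v, 'D_v (fun s => rsq2 (g s)) s = 0) -> rsq2 (g s) = c.
  move=> Ks cs; have [jn0 sn] := near_c _ Ks; apply: isolated => //.
  by have [] := legendrian_critical jn0 cs.
have K0 : unit_square !=set0.
  by exists 0 => i; rewrite mxE /= in_itv/= lexx ler01.
have cK : {within unit_square, continuous (fun s => rsq2 (g s))}.
  by apply: continuous_subspaceT => s; exact: differentiable_continuous.
have [m + Mm] := EVT_max_rV K0 unit_square_compact cK.
rewrite inE => Km.
have [n + Mn] := EVT_min_rV K0 unit_square_compact cK.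
rewrite inE => Kn.
have mE : rsq2 (g m) = c.
  apply: crit => // v; apply: derive_at_max => // s.
  by have [s' Ks' <-] := periodic_square s; apply: Mm; rewrite inE.
have nE : rsq2 (g n) = c.
  apply: crit => // v; apply: derive_at_min => // s.
  by have [s' Ks' <-] := periodic_square s; apply: Mn; rewrite inE.
have cE s : rsq2 (g s) = c.
  have [s' Ks' <-] := periodic_square s; apply/eqP.
  by rewrite eq_le -[X in _ <= X]mE -[X in _ && (X <= _)]nE Mm ?Mn ?inE.
move=> s; split => //; have [s' Ks' <-] := periodic_square s.
have [] // := @legendrian_critical s' (near_c _ Ks').1 => v.
by rewrite (_ : (fun s => _) = cst c) ?derive_cst//; exact/funext.
Qed.

End Torus.
End Rigidity.

(** * Legendrian isotopies preserve the standard tori *)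

Section NonIsotopy.
Variable R : realType.
Local Notation M := (biannulus_manifold R).
Implicit Types (s v : 'rV[R]_2).

(** Derivatives of the torus at time [t] become derivatives on the product, which are continuous
    jointly in time and parameter. *)
Lemma derive_slice (F : R * 'rV[R]_2 -> 'rV[R]_4) (t : R) s v :
  'D_v (fun s' => F (t, s')) s = 'D_(0, v) F (t, s).
Proof.
rewrite /derive; congr lim; apply: (congr1 (fun g => g @ 0^')).
apply/funext => h /=; congr (_ *: (F _ - _)).
have E : (h *: (0 : R) + t, h *: v + s) = (t, h *: v + s).
  by rewrite scaler0 add0r.
exact: esym E.
Qed.

Lemma continuous_jac2 (T : topologicalType) (f g h : T -> 'rV[R]_4) :
  continuous f -> continuous g -> continuous h ->
  continuous (fun x => jac2 (f x) (g x) (h x)).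
Proof.
have c (u : T -> 'rV[R]_4) j : continuous u ->
    continuous (fun x : T => (u x) 0 j : R).
  move=> cu x; apply: (@continuous_comp _ _ _ u (fun y : 'rV[R]_4 => y 0 j)).
    exact: cu.
  exact: coord_continuous.
have m (u w : T -> R) : continuous u -> continuous w ->
    continuous (fun x => u x * w x).
  by move=> cu cw x; apply: cvgM; [exact: cu|exact: cw].
have b (u w : T -> R) : continuous u -> continuous w ->
    continuous (fun x => u x - w x).
  by move=> cu cw x; apply: cvgB; [exact: cu|exact: cw].
move=> cf cg ch; rewrite /jac2 /ang1 /ang2.
by apply: (b); apply: (m); apply: (b); apply: (m); exact: c.
Qed.

Section Isotopy.
Variable F : R * 'rV[R]_2 -> M.
Hypothesis smoothF : smooth_map F.
Hypothesis legendrianF : forall t : R, 0 <= t <= 1 ->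
  legendrian_torus (biannulus_contact R) (fun s => F (t, s)).

Let G p : 'rV[R]_4 := \val (F p).

Lemma smooth_val : smooth_on setT G.
Proof. by move=> k; exact: (smoothF.2 (F (0, 0)) k). Qed.

Lemma val_continuous : continuous G.
Proof. by move=> p; exact: (smooth_val 0%N p I). Qed.

Lemma val_derive_continuous u : continuous (fun p => 'D_u G p).
Proof. by move=> p; exact: ((smooth_val 1%N).2 u p I). Qed.

(** Containment in the standard torus is recorded as equations on [G]: they are closed in [t], and
    they determine [c]. *)
Definition standard_at (c t : R) : Prop :=
  forall s, rsq1 (G (t, s)) = 1 /\ rsq2 (G (t, s)) = c.

Lemma continuous_rsq1_val : continuous (fun p => rsq1 (G p)).
Proof.
move=> p; apply: (@continuous_comp _ _ _ G (@rsq1 R)).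
  exact: val_continuous.
by apply: differentiable_continuous; exact: (has_diff_rsq1 _).1.
Qed.

Lemma continuous_rsq2_val : continuous (fun p => rsq2 (G p)).
Proof.
move=> p; apply: (@continuous_comp _ _ _ G (@rsq2 R)).
  exact: val_continuous.
by apply: differentiable_continuous; exact: (has_diff_rsq2 _).1.
Qed.

Lemma continuous_pairr s : continuous (fun t : R => (t, s)).
Proof.
move=> t; have ct : id @ t --> t by exact: cvg_id.
have cs : (fun=> s) @ t --> s by exact: cvg_cst.
by move=> A; exact: (cvg_pair ct cs).
Qed.

Lemma closed_standard c : closed [set t | standard_at c t].
Proof.
have -> : [set t | standard_at c t] = \bigcap_(s in setT)
    ((fun t : R => rsq1 (G (t, s))) @^-1` [set r | r = 1] `&`
     (fun t : R => rsq2 (G (t, s))) @^-1` [set r | r = c]).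
  by apply/seteqP; split => [t st s _|t st s]; [exact: st|exact: (st s I)].
apply: closed_bigI => s _; apply: closedI.
  have c1 : continuous (fun t : R => rsq1 (G (t, s))).
    move=> t; apply: (@continuous_comp _ _ _ (fun t : R => (t, s))
      (fun p => rsq1 (G p))); first exact: continuous_pairr.
    exact: continuous_rsq1_val.
  by move/continuous_closedP : c1; apply; exact: closed_eq.
have c2 : continuous (fun t : R => rsq2 (G (t, s))).
  move=> t; apply: (@continuous_comp _ _ _ (fun t : R => (t, s))
    (fun p => rsq2 (G p))); first exact: continuous_pairr.
  exact: continuous_rsq2_val.
by move/continuous_closedP : c2; apply; exact: closed_eq.
Qed.

(** It is nonzero where the two angular forms are independent on the torus at time [p.1], an open
    condition on [p]. *)
Let J p := jac2 (G p) ('D_(0, e0) G p) ('D_(0, e1) G p).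

Lemma slice_diff t s : 0 <= t <= 1 -> differentiable (fun s' => G (t, s')) s.
Proof.
move=> t01; have [[[_ sm] _ _] _] := legendrianF t01.
exact: ((sm (F (0, 0)) 1%N).1 s I).
Qed.

Lemma slice_tangent t s v : 0 <= t <= 1 ->
  v *m tangent_mx (fun s' => F (t, s')) s = 'D_v (fun s' => G (t, s')) s.
Proof. by move=> t01; rewrite deriveEjacobian//; exact: slice_diff. Qed.

Lemma standard_jac2 c t s : 0 < c -> 0 <= t <= 1 -> standard_at c t ->
  J (t, s) != 0.
Proof.
move=> c0 t01 st; rewrite /J -!derive_slice.
have dg s' : differentiable (fun s' => G (t, s')) s' by exact: slice_diff.
apply: (@jac2_neq0 R (fun s' => G (t, s')) dg 1 c s ltr01 c0).
- by move=> s'; exact: (st s').1.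
- by move=> s'; exact: (st s').2.
move=> v; rewrite -slice_tangent// => v0.
have [[_ _ imm] _] := legendrianF t01.
have free : row_free (tangent_mx (fun s' => F (t, s')) s).
  by apply/eqP; exact: imm.
by apply: (row_free_inj free); rewrite v0 mul0mx.
Qed.

(** Independence of the angular forms and closeness of [rsq2] to [c] hold on the whole torus at time
    [t]. Both are open conditions, so by compactness of the unit square they hold on it for all
    times near [t], where [legendrian_rigid] concludes. *)
Lemma open_standard c t : 0 < c ->
  (forall w : R, `|w - c| < pi -> sin w = 0 -> w = c) -> sin c = 0 ->
  0 <= t <= 1 -> standard_at c t ->
  \forall t' \near t, 0 <= t' <= 1 -> standard_at c t'.
Proof.
move=> c0 isolated sc t01 st.
pose P t' s := J (t', s) != 0 /\ `|rsq2 (G (t', s)) - c| < pi.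
have cJ : continuous J.
  apply: continuous_jac2; [exact: val_continuous|
    exact: val_derive_continuous|exact: val_derive_continuous].
have NC := (compact_near_coveringP _).1 (@unit_square_compact R).
have : \forall t' \near t, @unit_square R `<=` P t'.
  apply: (NC R (nbhs t) P) => s _.
  have Pn : \forall p \near (t, s), P p.1 p.2.
    have Jn := standard_jac2 s c0 t01 st.
    have cR : {for (t, s), continuous (fun p => rsq2 (G p))}.
      exact: continuous_rsq2_val.
    have nJ : \forall p \near (t, s), J p != 0.
      have : nbhs (J (t, s)) [set r | r != 0].
        by apply: open_nbhs_nbhs; split => //; exact: open_neq.
      by move/(cJ (t, s)).
    have nR : \forall p \near (t, s), `|c - rsq2 (G p)| < pi.
      by move/cvgrPdist_lt : cR => /(_ pi (pi_gt0 R)); rewrite (st s).2.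
    near=> p; rewrite /P -surjective_pairing; split; first by near: p.
    by rewrite distrC; near: p.
  (* The covering property puts the point of the compact set before the parameter, in the order
     opposite to that of the arguments of [G]. *)
  have sw : (fun q : 'rV[R]_2 * R => (q.2, q.1)) @ (s, t) --> (t, s).
    have c2 : snd @ (s, t) --> t by exact: cvg_snd.
    have c1 : fst @ (s, t) --> s by exact: cvg_fst.
    by move=> A; exact: (cvg_pair c2 c1).
  exact: (sw _ Pn).
apply: filterS => t' KP t'01.
have t'E := fun s => slice_diff s t'01.
apply: (legendrian_rigid (g := fun s => G (t', s)) t'E _ _ _ isolated sc).
- by move=> s; exact: set_valP.
- move=> s v; rewrite -slice_tangent//; apply/mem_ker_alpha.
  by have [_] := legendrianF t'01; exact.
- move=> s k; rewrite /G; congr (\val _).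
  have [[_ per _] _] := legendrianF t'01.
  apply/per; exists (- k).
  by rewrite map_mxN addrC addKr.
- by move=> s /KP[Jn dn]; split; [rewrite !derive_slice; exact: Jn|exact: dn].
Unshelve. all: by end_near. Qed.

(** The set of good times is nonempty, open and closed in the connected interval from 0 to 1. *)
Lemma standard_all c : 0 < c ->
  (forall w : R, `|w - c| < pi -> sin w = 0 -> w = c) -> sin c = 0 ->
  standard_at c 0 -> standard_at c 1.
Proof.
move=> c0 isolated sc s0.
pose B := [set` `[(0 : R), 1]] `&` [set t | standard_at c t].
suff BE : B = [set` `[(0 : R), 1]].
  have : [set` `[(0 : R), 1]] 1 by rewrite /= in_itv/= ler01 lexx.
  by rewrite -BE => -[].
apply: (@segment_connected R 0 1).
- by exists 0; split => //; rewrite /= in_itv/= ler01 lexx.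
(* The implication leaves times outside the interval unconstrained, since the Legendrian condition
   is known only inside; the interior is then an open set of R with the required trace. *)
- exists (interior [set t : R | 0 <= t <= 1 -> standard_at c t]).
    exact: open_interior.
  apply/seteqP; split=> t [t01 st]; split => //.
    by apply: open_standard => //; move: t01; rewrite /= in_itv.
  by have := interior_subset st; apply; move: t01; rewrite /= in_itv.
- by exists [set t | standard_at c t] => //; exact: closed_standard.
Qed.

End Isotopy.

(** Translation by [pi *+ n] changes the sine by a sign at most, and between -pi and pi its only
    zero is 0. *)
Lemma sin_zero_isolated (n : nat) (w : R) :
  `|w - pi *+ n| < pi -> sin w = 0 -> w = pi *+ n.
Proof.
rewrite -[in sin w](subrK (pi *+ n) w) (alternatingn (@sinDpi R)).
set y := w - _; move=> yp /eqP.
rewrite mulf_eq0 expf_eq0 oppr_eq0 oner_eq0 andbF /= => /eqP sy.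
apply/eqP; rewrite -subr_eq0 -/y; apply/eqP.
move: yp; rewrite ltr_norml => /andP[y1 y2].
have [yn|yp|//] := ltgtP y 0.
  have : 0 < sin (- y) by apply: sin_gt0_pi; lra.
  by rewrite sinN sy oppr0 ltxx.
have : 0 < sin y by apply: sin_gt0_pi; lra.
by rewrite sy ltxx.
Qed.

Lemma sin_pi_mulrn (n : nat) : sin (pi *+ n : R) = 0.
Proof. by rewrite -[pi *+ n]add0r (alternatingn (@sinDpi R)) sin0 mulr0. Qed.

(** The squared radii are zeros of the sine; the shift to [i.+1] excludes the radius 0. *)
Definition radius (i : nat) : R := Num.sqrt (pi *+ i.+1).

Lemma radius_gt0 i : 0 < radius i.
Proof. by rewrite sqrtr_gt0 pmulrn_lgt0// pi_gt0. Qed.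

Lemma radius_sqr i : radius i ^+ 2 = pi *+ i.+1.
Proof. by rewrite sqr_sqrtr// mulrn_wge0// pi_ge0. Qed.

(** The constant value of [rsq2] is carried along the isotopy from time 0, where it is [pi *+ i.+1],
    to time 1, where it is [pi *+ j.+1]. *)
Lemma torus_legendrian_isotopic i j :
  legendrian_isotopic (biannulus_contact R)
    (torus (radius i)) (torus (radius j)) -> i = j.
Proof.
move=> [F [smF legF [im0 _] [im1 _]]].
have on_torus k t : range (fun s => F (t, s)) = range (torus (radius k)) ->
    standard_at F (pi *+ k.+1) t.
  move=> imE s; have : range (fun s => F (t, s)) (F (t, s)) by exists s.
  rewrite imE => -[u _ <-]; rewrite val_torus; last exact/lt0r_neq0/radius_gt0.
  by rewrite rsq1_torus rsq2_torus radius_sqr.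
have c0 : 0 < (pi *+ i.+1 : R) by rewrite pmulrn_lgt0// pi_gt0.
have := standard_all smF legF c0 (@sin_zero_isolated i.+1) (sin_pi_mulrn i.+1)
  (on_torus i 0 im0) 0.
rewrite (on_torus j 1 im1 0).2 => -[_ /eqP].
rewrite -subr_eq0 -[_ *+ j.+1]mulr_natr -[_ *+ i.+1]mulr_natr -mulrBr.
rewrite mulf_eq0 gt_eqF ?pi_gt0//= subr_eq0 eqr_nat => /eqP[].
by [].
Qed.

End NonIsotopy.

Theorem theorem1p2 (R : realType) :
  exists (M : oriented_manifold R 4) (E : even_contact M)
         (L : nat -> 'rV[R]_2 -> M),
    (forall i, legendrian_torus E (L i)) /\
    (forall i j, i <> j -> ~ legendrian_isotopic E (L i) (L j)) /\
    (forall i j, smoothly_isotopic (L i) (L j)).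
Proof.
exists (biannulus_manifold R), (biannulus_contact R),
  (fun i => torus (radius R i)); split=> [i|].
  apply: torus_legendrian; first exact/lt0r_neq0/radius_gt0.
  by rewrite radius_sqr sin_pi_mulrn.
split=> [i j ij /torus_legendrian_isotopic//|i j].
by apply: torus_isotopic; exact: radius_gt0.
Qed.
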